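(* Let $g:\mathbb{R}^n\to\mathbb{R}_+$ be defined by $g(z)=\alpha\psi_\epsilon(a^\top z+b)$, with $\psi_\epsilon(e)=\max(|e|-\epsilon,0)$ for some $\epsilon\ge0$, $a\in\mathbb{R}^n\setminus\{0\}$, $b\in\mathbb{R}$, $\alpha>0$. Then for all $x\in\mathbb{R}^n$, $$\mathrm{prox}_g(x)=x-\alpha\,a\,d_{\sigma,\epsilon}(a^\top x+b),$$ with $\sigma=\epsilon+\alpha\|a\|_2^2$ and $$d_{\sigma,\epsilon}(e)=\begin{cases}\mathrm{sign}(e), & |e|>\sigma,\\ 0, & |e|<\epsilon,\\ \dfrac{1}{\sigma-\epsilon}\big(e-\epsilon\,\mathrm{sign}(e)\big), & \epsilon\le|e|\le\sigma.\end{cases}$$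
   Context: The proximal operator of $f:\mathbb{R}^n\to\mathbb{R}$ is $\mathrm{prox}_f(x)=\operatorname*{arg\,min}_{z\in\mathbb{R}^n}\big[\tfrac12\|z-x\|_2^2+f(z)\big]$. $\|\cdot\|_2$ is the Euclidean norm and $\mathbb{R}_+$ denotes the nonnegative reals. *)

(* Defs.v *)
From HB Require Import structures.
From mathcomp Require Import all_boot all_order all_algebra.
From mathcomp Require Import classical_sets reals interval_inference.

Set Implicit Arguments.
Unset Strict Implicit.
Unset Printing Implicit Defensive.

Import Order.TTheory GRing.Theory Num.Theory.
Local Open Scope classical_set_scope.
Local Open Scope ring_scope.

(* Not the library norm on matrices, which is the sup norm. *)
Definition norm2 (R : realType) (n : nat) (v : 'cV[R]_n) : R :=
  Num.sqrt (\sum_(i < n) v i 0 ^+ 2).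

Definition argmin (R : realType) (T : Type) (F : T -> R) : set T :=
  [set z | forall y, F z <= F y].

(* Set-valued: "prox f x is the point p" is expressed by
   [prox f x = [set p]], i.e. p is the unique minimizer. *)
Definition prox (R : realType) (n : nat) (f : 'cV[R]_n -> R) (x : 'cV[R]_n) :
    set 'cV[R]_n :=
  argmin (fun z => 2^-1 * norm2 (z - x) ^+ 2 + f z).

Definition psi (R : realType) (eps e : R) : R := Num.max (`|e| - eps) 0.

Definition dfun (R : realType) (sigma eps e : R) : R :=
  if sigma < `|e| then Num.sg e
  else if `|e| < eps then 0
  else (sigma - eps)^-1 * (e - eps * Num.sg e).

(* Main.v *)
Require Import Defs.
From HB Require Import structures.
From mathcomp Require Import all_boot all_order all_algebra.
From mathcomp Require Import classical_sets reals interval_inference.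
From mathcomp Require Import ring lra.

Set Implicit Arguments.
Unset Strict Implicit.
Unset Printing Implicit Defensive.

Import Order.TTheory GRing.Theory Num.Theory.
Local Open Scope classical_set_scope.
Local Open Scope ring_scope.

(** For eps >= 0, [psi eps] is the convex function
    s |-> max over |d| <= 1 of d * s - eps * |d|, so every such d gives a
    minorant of it with slope d ([psi_ge]).  With e the value of the affine form
    at x, d = [dfun sigma eps e] is the slope whose minorant touches
    [psi eps] exactly at e - (sigma - eps) * d ([psi_dfun]), and this is the
    value of the affine form at p = x - alpha d a, because
    sigma - eps = alpha |a|^2.  Hence d is a subgradient there, which is the
    optimality condition for p.  Quantitatively, expanding the square around p
    ([norm2D_sqr]) cancels the linear term against the subgradient inequality
    and leaves F(z) >= F(p) + |z - p|^2 / 2 for the proximal objective F.  This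
    gives both minimality and uniqueness ([argmin_quadratic_growth]). *)

Lemma norm2_sqr (R : realType) (n : nat) (v : 'cV[R]_n) :
  norm2 v ^+ 2 = (v^T *m v) 0 0.
Proof.
rewrite sqr_sqrtr; last by apply: sumr_ge0 => i _; exact: sqr_ge0.
by rewrite mxE; apply: eq_bigr => i _; rewrite mxE expr2.
Qed.

Lemma norm2_gt0 (R : realType) (n : nat) (v : 'cV[R]_n) :
  v != 0 -> 0 < norm2 v.
Proof.
move=> v_neq0; rewrite sqrtr_gt0 lt_neqAle eq_sym; apply/andP; split; last first.
  by apply: sumr_ge0 => i _; exact: sqr_ge0.
apply: contra_neq v_neq0 => /psumr_eq0P sum0.
apply/colP => i; rewrite mxE; apply/eqP; rewrite -sqrf_eq0; apply/eqP.
by apply: sum0 => // j _; exact: sqr_ge0.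
Qed.

Lemma norm2D_sqr (R : realType) (n : nat) (u v : 'cV[R]_n) :
  norm2 (u + v) ^+ 2 = norm2 u ^+ 2 + 2 * (v^T *m u) 0 0 + norm2 v ^+ 2.
Proof.
have dotC : (u^T *m v) 0 0 = (v^T *m u) 0 0.
  by rewrite -[in LHS](trmxK v) -trmx_mul mxE.
have entryD (A B : 'M[R]_1) : (A + B) 0 0 = A 0 0 + B 0 0 by rewrite mxE.
rewrite !norm2_sqr [(u + v)^T]raddfD /= mulmxDl !mulmxDr !entryD dotC; ring.
Qed.

Lemma argmin_quadratic_growth (R : realType) (n : nat) (F : 'cV[R]_n -> R)
    (p : 'cV[R]_n) :
  (forall z, F p + 2^-1 * norm2 (z - p) ^+ 2 <= F z) -> argmin F = [set p].
Proof.
move=> growth; apply/seteqP; split=> [z /(_ p) Fzp | _ -> z] /=.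
  apply/eqP; rewrite -subr_eq0; apply: contraT => /norm2_gt0 norm_gt0.
  have sqr_gt0 : 0 < norm2 (z - p) ^+ 2 by rewrite exprn_gt0.
  by have := growth z; lra.
by have := growth z; have := sqr_ge0 (norm2 (z - p)); lra.
Qed.

(** For eps >= 0 this is the Fenchel-Young inequality: the convex conjugate of
    [psi eps] is eps * |d| on the interval |d| <= 1 and infinite elsewhere. *)
Lemma psi_ge (R : realType) (eps d s : R) :
  `|d| <= 1 -> d * s - eps * `|d| <= psi eps s.
Proof.
move=> d_le1; have psi_ge0 : 0 <= psi eps s by rewrite /psi le_max lexx orbT.
have psi_geB : `|s| - eps <= psi eps s by rewrite /psi le_max lexx.
have ds_le : d * s <= `|d| * `|s| by rewrite -normrM ler_norm.
have scaled : `|d| * (`|s| - eps) <= `|d| * psi eps s by rewrite ler_wpM2l.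
have shrink : `|d| * psi eps s <= psi eps s by rewrite ler_piMl.
by lra.
Qed.

Lemma dfun_norm_le1 (R : realType) (sigma eps e : R) :
  0 <= eps -> eps < sigma -> `|dfun sigma eps e| <= 1.
Proof.
move=> eps_ge0 lt_es; have gap_gt0 : 0 < sigma - eps by rewrite subr_gt0.
rewrite /dfun; case: ltP => [|e_le]; first by rewrite normr_sg lern1; case: eqP.
case: ltP => [|e_ge]; first by rewrite normr0.
rewrite normrM gtr0_norm ?invr_gt0// mulrC ler_pdivrMr// mul1r.
case: (ltrgt0P e) e_le e_ge => [e_gt0|e_lt0|->] e_le e_ge.
- by rewrite gtr0_sg// mulr1 ger0_norm; lra.
- by rewrite ltr0_sg// mulrN1 ler0_norm; lra.
- by rewrite sgr0 mulr0 subr0 normr0 ltW.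
Qed.

(** The equality case of [psi_ge].  For |e| > sigma the shifted point stays
    beyond the kink on the same side as e; for eps <= |e| <= sigma it lands on
    the kink eps * sg e; for |e| < eps it is e itself, in the flat part. *)
Lemma psi_dfun (R : realType) (sigma eps e : R) :
  0 <= eps -> eps < sigma ->
  let d := dfun sigma eps e in
  let r := e - (sigma - eps) * d in
  psi eps r = d * r - eps * `|d|.
Proof.
move=> eps_ge0 lt_es d r; have gap_gt0 : 0 < sigma - eps by rewrite subr_gt0.
rewrite {}/r {}/d /dfun /psi; case: ltP => [e_gt|e_le].
  case: (ltrgt0P e) e_gt => [e_gt0|e_lt0|->] e_gt; last by lra.
  - by rewrite gtr0_sg// normr1 mulr1 ger0_norm ?max_l; lra.
  - by rewrite ltr0_sg// normrN1 mulrN1 ler0_norm ?max_l; lra.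
case: ltP => [e_lt|e_ge].
  by rewrite mulr0 subr0 normr0 mul0r mulr0 subr0 max_r; lra.
rewrite mulrA divff ?gt_eqF// mul1r subKr (normrM _^-1).
rewrite (gtr0_norm (x := _^-1)) ?invr_gt0//.
case: (ltrgt0P e) e_le e_ge => [e_gt0|e_lt0|->] e_le e_ge.
- rewrite gtr0_sg// mulr1 (ger0_norm eps_ge0) subrr maxxx.
  by rewrite ger0_norm ?subr_ge0//; ring.
- rewrite ltr0_sg// mulrN1 normrN (ger0_norm eps_ge0) subrr maxxx.
  by rewrite ler0_norm; [ring | lra].
(* Here e = 0 lies in the middle range only because eps = 0. *)
- have -> : eps = 0 by lra.
  by rewrite sgr0 mulr0 normr0 subrr maxxx mul0r mulr0 subr0.
Qed.

Theorem lemma16 (R : realType) (n : nat) (alpha eps b : R) (a : 'cV[R]_n)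
    (g : 'cV[R]_n -> {nonneg R})
    (alpha_gt0 : 0 < alpha) (eps_ge0 : 0 <= eps) (a_neq0 : a != 0)
    (gE : forall z : 'cV[R]_n,
        (g z)%:num = alpha * psi eps ((a^T *m z) 0 0 + b)) :
  let sigma := eps + alpha * norm2 a ^+ 2 in
  forall x : 'cV[R]_n,
    prox (fun z => (g z)%:num) x
    = [set x - (alpha * dfun sigma eps ((a^T *m x) 0 0 + b)) *: a].
Proof.
move=> sigma x; set e := (a^T *m x) 0 0 + b; set d := dfun sigma eps e.
have gapE : sigma - eps = alpha * norm2 a ^+ 2 by rewrite /sigma addrC addKr.
have lt_es : eps < sigma.
  by rewrite -subr_gt0 gapE mulr_gt0// exprn_gt0// norm2_gt0.
set p := x - (alpha * d) *: a.
have entryB (A B : 'M[R]_1) : (A - B) 0 0 = A 0 0 - B 0 0 by rewrite !mxE.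
have entryZ c (A : 'M[R]_1) : (c *: A) 0 0 = c * A 0 0 by rewrite mxE.
have entryN (A : 'M[R]_1) : (- A) 0 0 = - A 0 0 by rewrite mxE.
have pE : (a^T *m p) 0 0 + b = e - (sigma - eps) * d.
  by rewrite gapE norm2_sqr /e /p mulmxBr -scalemxAr entryB entryZ; ring.
apply: argmin_quadratic_growth => z; rewrite !gE.
have zE : (a^T *m z) 0 0 = (a^T *m p) 0 0 + (a^T *m (z - p)) 0 0.
  by rewrite (mulmxBr _ z p) entryB; ring.
have -> : z - x = (z - p) + (p - x) by rewrite addrA subrK.
rewrite (norm2D_sqr (z - p)).
have -> : ((p - x)^T *m (z - p)) 0 0 = - (alpha * d * (a^T *m (z - p)) 0 0).
  by rewrite /p addrAC subrr add0r [(- _)^T]linearN /= mulNmx entryN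
    [(_ *: _)^T]linearZ /= -scalemxAl entryZ.
have psi_p : psi eps ((a^T *m p) 0 0 + b)
    = d * ((a^T *m p) 0 0 + b) - eps * `|d|.
  by rewrite pE; exact: psi_dfun.
have subgrad : psi eps ((a^T *m p) 0 0 + b) + d * (a^T *m (z - p)) 0 0
    <= psi eps ((a^T *m z) 0 0 + b).
  have := psi_ge eps ((a^T *m z) 0 0 + b) (dfun_norm_le1 e eps_ge0 lt_es).
  by rewrite -/d psi_p zE; lra.
have := subgrad; rewrite -(ler_pM2l alpha_gt0); lra.
Qed.
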